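(* Let $p$ be a prime and let $Q \in \mathbb{Z}[x]$ be a nonzero polynomial. Then the sequence $V_p(Q) = \{\nu_p(Q(n)) : n \in \mathbb{N}\}$ is either periodic or unbounded. Moreover, $V_p(Q)$ is periodic if and only if $Q$ has no zeros in the ring $\mathbb{Z}_p$ of $p$-adic integers. In the periodic case, the minimal period length is a power of $p$.
   Context: $\mathbb{N} = \{0,1,2,\dots\}$. For a prime $p$ and a nonzero integer $m$, $\nu_p(m)$ is the exponent of the highest power of $p$ dividing $m$, and $\nu_p(0) = \infty$. A sequence $(s_n)_{n \in \mathbb{N}}$ is periodic if there is an integer $T \geq 1$ with $s_{n+T} = s_n$ for all $n \in \mathbb{N}$; the least such $T$ is the minimal period length. Powers of $p$ include $p^0 = 1$. A sequence with values in $\mathbb{N} \cup \{\infty\}$ is unbounded if it is not bounded above by any element of $\mathbb{N}$. *)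

(* Defs.v *)
From HB Require Import structures.
From mathcomp Require Import all_boot all_order all_algebra.
From mathcomp Require Import boolp.
Set Implicit Arguments.
Unset Strict Implicit.
Unset Printing Implicit Defensive.
Import GRing.Theory.
Local Open Scope ring_scope.

(** * The ring of p-adic integers

    Z_p is the inverse limit of the rings Z/p^k. The index is shifted so that
    component [n] lives modulo [p ^ n.+1]: the factor k = 0 is trivial, and
    ['Z_1] is not the zero ring in MathComp. *)

Definition padic_red (p n : nat) (a : 'Z_(p ^ n.+2)) : 'Z_(p ^ n.+1) := inZp a.

Record padic_int (p : nat) := PadicInt {
  padic_comp :> forall n : nat, 'Z_(p ^ n.+1);
  padic_coh : forall n : nat, padic_red (padic_comp n.+1) = padic_comp n
}.

Section PadicRing.
Variable p : nat.

Lemma dvdn_Zp_trunc n :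
  ((Zp_trunc (p ^ n.+1)).+2 %| (Zp_trunc (p ^ n.+2)).+2)%N.
Proof.
case: (ltnP 1 p) => [p_gt1|]; last first.
  by case: p => [|[|//]] _; rewrite ?exp0n ?exp1n.
have gt1 k : (1 < p ^ k.+1)%N by rewrite -(exp1n k.+1) ltn_exp2r.
by rewrite !Zp_cast // (expnS p n.+1) dvdn_mull.
Qed.

Lemma padic_redD n : {morph @padic_red p n : x y / x + y}.
Proof.
move=> x y; apply: val_inj => /=.
by rewrite modn_dvdm ?dvdn_Zp_trunc // modnDm.
Qed.

Lemma padic_redM n : {morph @padic_red p n : x y / x * y}.
Proof.
move=> x y; apply: val_inj => /=.
by rewrite modn_dvdm ?dvdn_Zp_trunc // modnMm.
Qed.

Lemma padic_red0 n : @padic_red p n 0 = 0.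
Proof. by apply: val_inj; rewrite /= mod0n. Qed.

Lemma padic_red1 n : @padic_red p n 1 = 1.
Proof. by apply: val_inj; rewrite /= !modn_small. Qed.

Lemma padic_redN n : {morph @padic_red p n : x / - x}.
Proof.
move=> x; apply: (addrI (padic_red x)).
by rewrite -padic_redD !subrr padic_red0.
Qed.

Lemma padic_int_eq (x y : padic_int p) : (forall n, x n = y n) -> x = y.
Proof.
case: x y => [x hx] [y hy] /= exy.
have {}exy : x = y by apply: functional_extensionality_dep.
by case: y / exy hy => hy; rewrite (Prop_irrelevance hx hy).
Qed.

Definition padic_zero : padic_int p :=
  @PadicInt p (fun=> 0) (fun n => padic_red0 n).

Definition padic_one : padic_int p :=
  @PadicInt p (fun=> 1) (fun n => padic_red1 n).

Definition padic_add (x y : padic_int p) : padic_int p.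
Proof.
exists (fun n => x n + y n) => n.
by rewrite padic_redD !padic_coh.
Defined.

Definition padic_opp (x : padic_int p) : padic_int p.
Proof.
exists (fun n => - x n) => n.
by rewrite padic_redN padic_coh.
Defined.

Definition padic_mul (x y : padic_int p) : padic_int p.
Proof.
exists (fun n => x n * y n) => n.
by rewrite padic_redM !padic_coh.
Defined.

HB.instance Definition _ := gen_eqMixin (padic_int p).
HB.instance Definition _ := gen_choiceMixin (padic_int p).

Lemma padic_addA : associative padic_add.
Proof. by move=> x y z; apply: padic_int_eq => n; apply: addrA. Qed.

Lemma padic_addC : commutative padic_add.
Proof. by move=> x y; apply: padic_int_eq => n; apply: addrC. Qed.

Lemma padic_add0 : left_id padic_zero padic_add.
Proof. by move=> x; apply: padic_int_eq => n; apply: add0r. Qed.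

Lemma padic_addN : left_inverse padic_zero padic_opp padic_add.
Proof. by move=> x; apply: padic_int_eq => n; apply: addNr. Qed.

HB.instance Definition _ := GRing.isZmodule.Build (padic_int p)
  padic_addA padic_addC padic_add0 padic_addN.

Lemma padic_mulA : associative padic_mul.
Proof. by move=> x y z; apply: padic_int_eq => n; apply: mulrA. Qed.

Lemma padic_mulC : commutative padic_mul.
Proof. by move=> x y; apply: padic_int_eq => n; apply: mulrC. Qed.

Lemma padic_mul1 : left_id padic_one padic_mul.
Proof. by move=> x; apply: padic_int_eq => n; apply: mul1r. Qed.

Lemma padic_mulD : left_distributive padic_mul padic_add.
Proof. by move=> x y z; apply: padic_int_eq => n; apply: mulrDl. Qed.

Lemma padic_one_neq0 : padic_one != padic_zero.
Proof.
apply/eqP => /(congr1 (fun x : padic_int p => x 0%N)) /= /eqP.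
by rewrite oner_eq0.
Qed.

HB.instance Definition _ := GRing.Zmodule_isComNzRing.Build (padic_int p)
  padic_mulA padic_mulC padic_mul1 padic_mulD padic_one_neq0.

End PadicRing.

Definition has_padic_zero (p : nat) (Q : {poly int}) : Prop :=
  exists z : padic_int p, root (map_poly intr Q) z.

(** * Valuations and sequences with values in N U {oo} *)

(* [None] stands for oo. *)
Definition nu (p : nat) (m : int) : option nat :=
  if m == 0 then None else Some (logn p `|m|%N).

Definition V (p : nat) (Q : {poly int}) (n : nat) : option nat :=
  nu p Q.[n%:Z].

Definition is_period (T : Type) (s : nat -> T) (t : nat) : Prop :=
  (0 < t)%N /\ forall n : nat, s (n + t)%N = s n.

Definition periodic (T : Type) (s : nat -> T) : Prop :=
  exists t : nat, is_period s t.

Definition minimal_period (T : Type) (s : nat -> T) (t : nat) : Prop :=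
  is_period s t /\ forall t' : nat, is_period s t' -> (t <= t')%N.

Definition bounded_by (s : nat -> option nat) (M : nat) : Prop :=
  forall n : nat, exists2 k : nat, s n = Some k & (k <= M)%N.

Definition unbounded (s : nat -> option nat) : Prop :=
  ~ exists M : nat, bounded_by s M.

(* Main.v *)
Require Import Defs.
From mathcomp Require Import all_boot all_order all_algebra.
From HB Require Import structures.
From mathcomp Require Import boolp.

(** Congruent arguments give congruent values of [Q], so once [p ^ M] never
    divides [Q(n)], the valuation of [Q(n)] depends only on [n] modulo [p ^ M]:
    a bounded sequence is periodic, and its minimal period divides [p ^ M].
    Conversely a periodic sequence takes finitely many values, and none of them
    is infinite because [Q] has finitely many roots.  Unboundedness amounts to a
    p-adic zero: reducing a zero modulo [p ^ k] gives [n] with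
    [p ^ k %| Q(n)], and arguments of arbitrarily large valuation accumulate,
    by compactness of Z_p, at a zero. *)

Set Implicit Arguments.
Unset Strict Implicit.
Unset Printing Implicit Defensive.
Import GRing.Theory.
Local Open Scope ring_scope.

Lemma is_period_mull (T : Type) (s : nat -> T) (t : nat) :
  is_period s t -> forall k n : nat, s (n + k * t)%N = s n.
Proof.
move=> [_ st]; elim=> [|k IHk] n; first by rewrite mul0n addn0.
by rewrite mulSn addnA IHk st.
Qed.

Lemma periodic_minimal_period (T : Type) (s : nat -> T) :
  periodic s -> exists t : nat, minimal_period s t.
Proof.
move=> [t0 /asboolP st0].
have ex_t : exists t, `[< is_period s t >] by exists t0.
case: (ex_minnP ex_t) => t /asboolP st t_min.
by exists t; split=> // t' /asboolP; apply: t_min.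
Qed.

(** If [t] did not divide [u], the remainder of [u] modulo [t] would be a smaller period. *)
Lemma minimal_period_dvdn (T : Type) (s : nat -> T) (t u : nat) :
  minimal_period s t -> is_period s u -> (t %| u)%N.
Proof.
move=> [st t_min] [_ su]; rewrite /dvdn; apply/eqP.
case: (posnP (u %% t)%N) => // r_gt0.
have sr : is_period s (u %% t)%N.
  split=> // n.
  by rewrite -(is_period_mull st (u %/ t)) -addnA [(_ %% _ + _)%N]addnC -divn_eq.
by have := t_min _ sr; rewrite leqNgt ltn_mod st.1.
Qed.

Lemma dvdz_horner_sub (Q : {poly int}) (a b : int) :
  (a - b %| Q.[a] - Q.[b])%Z.
Proof.
have /factor_theorem[q Qq] : root (Q - Q.[b]%:P) b.
  by rewrite /root !hornerE subrr.
have := congr1 (horner^~ a) Qq; rewrite !hornerE => ->.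
exact: dvdz_mull.
Qed.

Lemma dvdz_congr (d a b : int) : (d %| a - b)%Z -> (d %| a)%Z = (d %| b)%Z.
Proof. by move=> dab; rewrite -[a](subrK b) rpredDl. Qed.

Lemma horner_dvdz_modn (Q : {poly int}) (d m n : nat) :
  m = n %[mod d] -> (d %| Q.[m])%Z = (d %| Q.[n])%Z.
Proof.
move=> mn; apply: dvdz_congr; apply: dvdz_trans (dvdz_horner_sub Q m n).
by rewrite -eqz_mod_dvd !modz_nat mn.
Qed.

(** Already [size Q] distinct roots exceed the degree of [Q]. *)
Lemma no_inj_seq_nat_roots (Q : {poly int}) :
  Q != 0 -> ~ exists f : nat -> nat, injective f /\ forall k, root Q (f k)%:Z.
Proof.
move=> Q0 [f [f_inj fP]].
have := @max_poly_roots _ Q [seq (f k)%:Z | k <- iota 0 (size Q)] Q0.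
rewrite size_map size_iota ltnn => H; suff: false by [].
apply: H; first by apply/allP => _ /mapP[k _ ->].
by rewrite map_inj_uniq ?iota_uniq // => a b [] /f_inj.
Qed.

Section Valuation.
Variables (p : nat) (p_prime : prime p).

Lemma dvdz_nu (a : int) (k : nat) :
  ((p ^ k)%N %| a)%Z = if nu p a is Some m then (k <= m)%N else true.
Proof.
rewrite /nu; case: eqP => [->|/eqP a0]; first exact: dvdz0.
by rewrite dvdzE /= pfactor_dvdn // absz_gt0.
Qed.

Lemma eq_nu (a b : int) :
  (forall k : nat, ((p ^ k)%N %| a)%Z = ((p ^ k)%N %| b)%Z) -> nu p a = nu p b.
Proof.
move=> ab; move: ab (fun k => dvdz_nu a k) (fun k => dvdz_nu b k) => ab.
case: (nu p a) (nu p b) => [m|] [n|] // am bn.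
- congr Some; apply/eqP; rewrite eqn_leq -bn -ab am leqnn /=.
  by rewrite -am ab bn leqnn.
- by have := ltnn m; rewrite -am ab bn.
- by have := ltnn n; rewrite -bn -ab am.
Qed.

(** Infinite values need no separate clause: every power of [p] divides 0. *)
Lemma bounded_by_dvdz (Q : {poly int}) (M : nat) :
  bounded_by (V p Q) M <-> forall n : nat, ~~ ((p ^ M.+1)%N %| Q.[n%:Z])%Z.
Proof.
split=> [QM n | QM n]; last first.
  have := QM n; rewrite dvdz_nu -/(V p Q n).
  by case: (V p Q n) => // k; rewrite -leqNgt => kM; exists k.
by have [k Vk kM] := QM n; rewrite dvdz_nu -/(V p Q n) Vk -leqNgt.
Qed.

Lemma bounded_is_period (Q : {poly int}) (M : nat) :
  bounded_by (V p Q) M -> is_period (V p Q) (p ^ M.+1).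
Proof.
move=> /bounded_by_dvdz QM; split=> [|n]; first by rewrite expn_gt0 prime_gt0.
(* For [k <= M.+1] the shift by [p ^ M.+1] is trivial modulo [p ^ k]; for larger [k], neither value
   is divisible by [p ^ k]. *)
apply: eq_nu => k; case: (leqP k M.+1) => kM.
  apply: horner_dvdz_modn; apply/eqP.
  by rewrite -[X in _ == X %[mod _]]addn0 eqn_modDl mod0n; apply: dvdn_exp2l.
have notdvd m : ((p ^ k)%N %| Q.[m%:Z])%Z = false.
  apply: contraNF (QM m); apply: dvdz_trans.
  by rewrite dvdzE /=; apply: dvdn_exp2l; apply: ltnW.
by rewrite !notdvd.
Qed.

Lemma periodic_bounded (Q : {poly int}) :
  Q != 0 -> periodic (V p Q) -> exists M : nat, bounded_by (V p Q) M.
Proof.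
move=> Q0 [t Qt]; have t_gt0 := Qt.1.
(* The maximum over one period; the default 0 for infinite values is harmless, since these are ruled
   out below. *)
exists (\max_(i < t) odflt 0 (V p Q i))%N => n.
have Vmod : V p Q n = V p Q (n %% t)%N.
  by rewrite [in LHS](divn_eq n t) addnC is_period_mull.
case Vn : (V p Q n) => [k|].
  exists k => //.
  have := @leq_bigmax _ (fun i : 'I_t => odflt 0%N (V p Q i))
            (Ordinal (ltn_pmod n t_gt0)).
  by rewrite /= -Vmod Vn.
(* An infinite value at [n] would make every term of the progression [n + k * t] a root. *)
case: (no_inj_seq_nat_roots Q0); exists (fun k => n + k * t)%N; split.
  by move=> a b /addnI /eqP; rewrite eqn_pmul2r // => /eqP.
move=> k; have := is_period_mull Qt k n.
by rewrite Vn /V /nu /root; case: eqP.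
Qed.

(* Compactness of Z_p: [a] lists the residues modulo p^k of an accumulation
   point of the sets [D m]. *)
Lemma padic_accumulation (D : nat -> nat -> Prop) :
    (forall m n, D m.+1 n -> D m n) -> (forall m, exists n, D m n) ->
  exists a : nat -> nat, forall k, a k.+1 = a k %[mod p ^ k] /\
    forall m, exists2 n, n = a k %[mod p ^ k] & D m n.
Proof.
move=> decD exD.
have {}decD m m' n : (m <= m')%N -> D m' n -> D m n.
  move=> /subnK <-; elim: (m' - m)%N => // j IHj.
  by rewrite addSn => /decD.
(* The residue class of [c] modulo [p ^ k] meets every [D m]. *)
pose good k c := forall m, exists2 n, n = c %[mod p ^ k] & D m n.
(* A good class contains a good class one level deeper. Goodness is assumed under the existential so
   that choice yields a total function. *)
have step (kc : nat * nat) : exists b, good kc.1 kc.2 ->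
    b = kc.2 %[mod p ^ kc.1] /\ good kc.1.+1 b.
  case: kc => k c /=; apply: contrapT => nob.
  have gkc : good k c.
    by apply: contrapT => ngkc; apply: nob; exists 0%N => /ngkc.
  have escape (r : 'I_(p ^ k.+1)) : exists m,
      r = c %[mod p ^ k] -> forall n, n = r %[mod p ^ k.+1] -> ~ D m n.
    apply: contrapT => nom; apply: nob; exists (val r) => _; split.
      by apply: contrapT => rc; apply: nom; exists 0%N => /rc.
    move=> m; apply: contrapT => nD; apply: nom; exists m => _ n nr Dn.
    by apply: nD; exists n.
  have [f fP] := choice escape.
  (* If each of the finitely many subclasses misses some [D m], then beyond the largest such [m] the
     whole class misses [D m], as the sets decrease. *)
  have [n nc Dn] := gkc (\max_r f r)%N.
  have q_gt0 : (0 < p ^ k.+1)%N by rewrite expn_gt0 prime_gt0.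
  apply: (fP (Ordinal (ltn_pmod n q_gt0)) _ n) => /=.
  - by rewrite modn_dvdm // expnS dvdn_mull.
  - by rewrite modn_mod.
  - by apply: decD Dn; apply: leq_bigmax.
have [f fP] := choice step.
pose a := fix a k := if k is j.+1 then f (j, a j) else 0%N.
have ga k : good k (a k).
  elim: k => [m|k gk]; last by case: (fP (k, a k) gk).
  have [n Dn] := exD m.
  by exists n; rewrite // expn0 !modn1.
by exists a => k; split; [case: (fP (k, a k) (ga k)) | apply: ga].
Qed.

Let expp_gt1 (n : nat) : (1 < p ^ n.+1)%N.
Proof. by rewrite -(exp1n n.+1) ltn_exp2r // prime_gt1. Qed.

Lemma intr_Zp_eq0 (q : nat) (a : int) :
  (1 < q)%N -> (a%:~R == 0 :> 'Z_q) = (q %| a)%Z.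
Proof.
move=> q_gt1.
have nat_eq0 (n : nat) : (n%:R == 0 :> 'Z_q) = (q %| n)%N.
  by rewrite -val_eqE /= val_Zp_nat.
rewrite dvdzE /=; case: a => n; first exact: nat_eq0.
by rewrite NegzE mulrNz oppr_eq0 abszN; apply: nat_eq0.
Qed.

(** A named form of the coercion, able to carry the ring morphism structure. *)
Definition padic_proj (n : nat) (z : padic_int p) : 'Z_(p ^ n.+1) := z n.

Fact padic_proj_zmod_morphism n : zmod_morphism (padic_proj n).
Proof. by []. Qed.

Fact padic_proj_monoid_morphism n : monoid_morphism (padic_proj n).
Proof. by []. Qed.

HB.instance Definition _ n := GRing.isZmodMorphism.Build
  (padic_int p) 'Z_(p ^ n.+1) (padic_proj n) (padic_proj_zmod_morphism n).
HB.instance Definition _ n := GRing.isMonoidMorphism.Build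
  (padic_int p) 'Z_(p ^ n.+1) (padic_proj n) (padic_proj_monoid_morphism n).

(** A p-adic integer is 0 iff all its components are, and the projections, being ring morphisms,
    commute with evaluating [Q]. *)
Lemma root_padic (Q : {poly int}) (z : padic_int p) :
  root (map_poly intr Q) z <->
  forall n, ((p ^ n.+1)%N %| Q.[(val (z n))%:Z])%Z.
Proof.
have projQ n : (padic_proj n (map_poly intr Q).[z] == 0) =
               ((p ^ n.+1)%N %| Q.[(val (z n))%:Z])%Z.
  rewrite -intr_Zp_eq0 // -horner_map -map_poly_comp /=.
  rewrite (eq_map_poly (g := intr)) => [|c /=]; last by rewrite rmorph_int.
  by rewrite -[in RHS]horner_map /= -pmulrn natr_Zp.
split=> [/eqP Qz n|Qz]; first by rewrite -projQ Qz rmorph0.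
by apply/eqP; apply: padic_int_eq => n; apply/eqP; rewrite [_ == _]projQ.
Qed.

Lemma padic_int_of_seq (a : nat -> nat) :
    (forall k, a k.+1 = a k %[mod p ^ k]) ->
  exists z : padic_int p, forall n, val (z n) = a n.+1 %[mod p ^ n.+1].
Proof.
(* The shift to [a n.+1] matches component [n] living modulo [p ^ n.+1]. *)
move=> aP; pose c n : 'Z_(p ^ n.+1) := inZp (a n.+1).
have cP n : padic_red (c n.+1) = c n.
  by apply: val_inj; rewrite /= modn_dvdm ?dvdn_Zp_trunc // !Zp_cast.
by exists (PadicInt cP) => n; rewrite /= Zp_cast // modn_mod.
Qed.

Lemma has_padic_zeroP (Q : {poly int}) :
  has_padic_zero p Q <-> unbounded (V p Q).
Proof.
split=> [[z /root_padic Qz] [M /bounded_by_dvdz QM]|unbQ].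
  (* Component [M] of the zero gives an argument where [p ^ M.+1] divides the value of [Q]. *)
  by have := QM (val (z M)); rewrite Qz.
have [m n|m|a aP] := @padic_accumulation
    (fun m n => ((p ^ m)%N %| Q.[n%:Z])%Z).
- by apply: dvdz_trans; rewrite dvdzE /= expnS dvdn_mull.
- apply: contrapT => noQ; apply: unbQ; exists m; apply/bounded_by_dvdz => n.
  apply/negP => Qn; apply: noQ; exists n; apply: dvdz_trans Qn.
  by rewrite dvdzE /= expnS dvdn_mull.
have [z zP] := padic_int_of_seq (fun k => (aP k).1).
(* Some [m] congruent to [z n] modulo [p ^ n.+1] has [p ^ n.+1] dividing [Q(m)], and this
   divisibility passes to [z n]. *)
exists z; apply/root_padic => n; have [m ma Qm] := (aP n.+1).2 n.+1.
by rewrite (@horner_dvdz_modn _ _ _ m) // zP ma.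
Qed.

End Valuation.

Theorem theorem2p1 (p : nat) (Q : {poly int}) (p_prime : prime p)
    (Q_neq0 : (Q != 0)%R) :
  [/\ (periodic (V p Q) \/ unbounded (V p Q)) /\
        ~ (periodic (V p Q) /\ unbounded (V p Q)),
      periodic (V p Q) <-> ~ has_padic_zero p Q
    & periodic (V p Q) -> exists k : nat, minimal_period (V p Q) (p ^ k)].
Proof.
have perP : periodic (V p Q) <-> exists M, bounded_by (V p Q) M.
  split; first exact: periodic_bounded.
  by move=> [M /(bounded_is_period p_prime)]; exists (p ^ M.+1)%N.
split.
- split; last by move=> [/perP].
  by case: (pselect (exists M, bounded_by (V p Q) M)) => [/perP|]; [left|right].
- rewrite has_padic_zeroP // perP /unbounded; split; first by move=> ? /(_ _).
  exact: contrapT.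
- move=> perQ; have [t Qt] := periodic_minimal_period perQ.
  have [M /(bounded_is_period p_prime) QM] := perP.1 perQ.
  (* The minimal period divides the period [p ^ M.+1], hence is itself a power of [p]. *)
  have /(dvdn_pfactor _ _ p_prime)[k _ tk] := minimal_period_dvdn Qt QM.
  by exists k; rewrite -tk.
Qed.
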